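(* Let $P$ be a non-$\Sigma$ operad in $\mathcal{C}$, $A$ a $P$-algebra in $\mathcal{D}$, $M$ an $A$-bimodule, and $R:({}^{0}\!\mathbf{\Delta}C_P)^{op}\to\mathcal{C}$ a $\mathcal{C}$-functor. Then giving an $R$-trace on $(A,M)$ with target $B$ is equivalent to giving a map $R\otimes_{{}^{0}\!\mathbf{\Delta}C_P}B^{cy}_\bullet(A;M)\to B$ in $\mathcal{D}$: there is a bijection between $R$-traces on $(A,M)$ with target $B$ and such maps, natural in the object $B$ of $\mathcal{D}$.
   Context: $\mathcal{C}$ is a closed symmetric monoidal category with unit $I$ and $\mathcal{D}$ is a closed symmetric monoidal $\mathcal{C}$-category (enriched, tensored and cotensored over $\mathcal{C}$, compatibly with its symmetric monoidal structure); both have countable limits and colimits. All tensor products (including tensors of objects of $\mathcal{D}$ with objects of $\mathcal{C}$) are written $\otimes$. A non-$\Sigma$ operad $P$ (with a zeroth object $P(0)$) assigns an object $P(S)$ to each finite linearly ordered set $S$ (functorially in order isomorphisms), with associative and unital structure maps $P(T)\otimes P[f]\to P(S)$ for order-preserving $f:S\to T$, where $P[f]=\bigotimes_{t\in T}P(f^{-1}(t))$, and unit $I\to P(1)$. A $P$-algebra $A$ has structure maps $P(S)\otimes A^{\otimes S}\to A$. An $A$-bimodule $M$ has structure maps $P(n)\otimes A^{\otimes i-1}\otimes M\otimes A^{\otimes n-i}\to M$ for $n\ge1$, $1\le i\le n$, satisfying the usual associativity and unit conditions. ${}^{0}\!\mathbf{\Delta}C$ is the category of finite cyclically ordered sets with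 basepoint $0$; a morphism $S\to T$ is a basepoint-preserving map $f$ together with a linear ordering of each fiber such that the cyclic order of $S$ is the concatenation of the ordered fibers in the cyclic order of $T$; composites have fibers ordered by concatenation. We use the skeleton with one object of each cardinality $\ge1$. ${}^{0}\!\mathbf{\Delta}C_P$ is the $\mathcal{C}$-category with the same objects, $Hom(S,T)=\coprod_{f:S\to T}P[f]$ (coproduct over morphisms of ${}^{0}\!\mathbf{\Delta}C$), and composition induced by the operad structure. Thus $R$ has structure maps $R(T)\otimes P[f]\to R(S)$. The cyclic bar construction is the $\mathcal{C}$-functor $B^{cy}_\bullet(A;M):{}^{0}\!\mathbf{\Delta}C_P\to\mathcal{D}$, $S\mapsto M\otimes A^{\otimes S-\{0\}}$, with $M$ thought of as the factor indexed by $0$. For $f:S\to T$ the structure map $P[f]\otimes M\otimes A^{\otimes S-\{0\}}\to M\otimes A^{\otimes T-\{0\}}$ uses the algebra structure maps $P(f^{-1}(t))\otimes A^{\otimes f^{-1}(t)}\to A$ for $t\neq0$, and for $t=0$ the bimodule structure map of $P(f^{-1}(0))$ on the factors indexed by $f^{-1}(0)$ in their linear order ($M$ in the position of $0$), after permuting factors accordingly. $\mathcal{E}_{A,M,B}:({}^{0}\!\mathbf{\Delta}C_P)^{op}\to\mathcal{C}$ is the functor $\mathcal{E}_{A,M,B}(S)=Hom_{\mathcal{D}}(M\otimes A^{\otimes S-\{0\}},B)$ (the $\mathcal{C}$-valued hom), with structure given by precomposition with the structure maps of $B^{cy}_\bullet(A;M)$. An $R$-trace on $(A,M)$ with target $B$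 is a ($\mathcal{C}$-enriched) natural transformation $R\to\mathcal{E}_{A,M,B}$. For a $\mathcal{C}$-functor $F:{}^{0}\!\mathbf{\Delta}C_P\to\mathcal{D}$, the object $R\otimes_{{}^{0}\!\mathbf{\Delta}C_P}F$ is the coequalizer of the two evident maps $$\coprod_{f:S\to T}R(T)\otimes P[f]\otimes F(S)\rightrightarrows\coprod_{S}R(S)\otimes F(S)$$ induced by $R(T)\otimes P[f]\to R(S)$ and $P[f]\otimes F(S)\to F(T)$. *)

(* Defs.v *)
From mathcomp Require Import all_boot.
Set Implicit Arguments.
Unset Strict Implicit.
Unset Printing Implicit Defensive.

Declare Scope cat_scope.
Open Scope cat_scope.
Reserved Notation "x ~> y" (at level 60, no associativity).
Reserved Notation "g ∘ f" (at level 45, right associativity).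
Reserved Notation "x ⊗ y" (at level 40, left associativity).
Reserved Notation "f ⊠ g" (at level 40, left associativity).

Record cat := Cat {
  ob :> Type;
  hom : ob -> ob -> Type;
  idm : forall x, hom x x;
  comp : forall x y z, hom y z -> hom x y -> hom x z;
  comp1m : forall x y (f : hom x y), comp (idm y) f = f;
  compm1 : forall x y (f : hom x y), comp f (idm x) = f;
  compA : forall x y z w (h : hom z w) (g : hom y z) (f : hom x y),
    comp h (comp g f) = comp (comp h g) f }.
Arguments idm {c} x.
Arguments hom {c} x y.
Notation "x ~> y" := (hom x y) : cat_scope.
Notation "g ∘ f" := (comp g f) : cat_scope.

Definition opcat (X : cat) : cat.
Proof.
refine (@Cat X (fun x y => y ~> x) (fun x => idm x)
              (fun x y z g f => f ∘ g) _ _ _).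
- by move=> x y f; rewrite compm1.
- by move=> x y f; rewrite comp1m.
- by move=> x y z w h g f; rewrite compA.
Defined.

Definition tr (X : cat) (x y : X) (e : x = y) : x ~> y :=
  match e in _ = y' return x ~> y' with erefl => idm x end.

Record isIso (X : cat) (x y : X) (f : x ~> y) := IsIso {
  isoV : y ~> x;
  isoVK : isoV ∘ f = idm x;
  isoKV : f ∘ isoV = idm y }.

Record functor (J X : cat) := Functor {
  fob :> J -> X;
  fmor : forall i j, i ~> j -> fob i ~> fob j;
  fmor_id : forall i, fmor (idm i) = idm (fob i);
  fmor_comp : forall i j k (g : j ~> k) (f : i ~> j),
    fmor (g ∘ f) = fmor g ∘ fmor f }.

Record cocone (J X : cat) (F : functor J X) (c : X) := Cocone {
  leg :> forall i, F i ~> c;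
  legE : forall i j (f : i ~> j), leg j ∘ fmor F f = leg i }.

Record colimit (J X : cat) (F : functor J X) := Colimit {
  colim : X;
  colim_leg : cocone F colim;
  colim_desc : forall c, cocone F c -> colim ~> c;
  colim_fac : forall c (k : cocone F c) i, colim_desc k ∘ colim_leg i = k i;
  colim_uniq : forall c (f g : colim ~> c),
    (forall i, f ∘ colim_leg i = g ∘ colim_leg i) -> f = g }.

Definition countableT (T : Type) := exists f : T -> nat, injective f.

Definition countableCat (J : cat) :=
  countableT J /\ forall i j : J, countableT (i ~> j).

(* Chosen colimits of all countable diagrams; limits are colimits in the     *)
(* opposite category (countable shapes are closed under opposites).         *)
Definition countablyCocomplete (X : cat) :=
  forall J : cat, countableCat J -> forall F : functor J X, colimit F.
Definition countablyComplete (X : cat) := countablyCocomplete (opcat X).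

Definition discrete (T : Type) : cat.
Proof.
refine (@Cat T (fun x y => x = y) (fun x => erefl)
               (fun x y z q p => etrans p q) _ _ _).
- by move=> x y f; case: y / f.
- by move=> x y f; case: y / f.
- by move=> x y z w h; case: w / h.
Defined.

Lemma discrete_countable (T : countType) : countableCat (discrete T).
Proof.
split=> [|x y]; first by exists pickle; apply: pcan_inj pickleK.
by exists (fun _ => 0) => p q _; apply: eq_irrelevance.
Qed.

Definition discreteFunctor (X : cat) (T : Type) (F : T -> X) :
  functor (discrete T) X.
Proof.
refine (@Functor (discrete T) X F (fun x y p => tr (congr1 F p)) _ _) => //.
by move=> i j k g; destruct g => f; rewrite /= comp1m.
Defined.

Definition discreteCocone (X : cat) (T : Type) (F : T -> X) (c : X)
  (k : forall j, F j ~> c) : cocone (discreteFunctor F) c.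
Proof.
refine (@Cocone _ _ (discreteFunctor F) c k _).
by move=> i j f; case: j / f; rewrite compm1.
Defined.

Section Coproducts.
Variables (X : cat) (XC : countablyCocomplete X) (T : countType) (F : T -> X).

Definition coprodColimit : colimit (discreteFunctor F) :=
  XC (discrete_countable T) (discreteFunctor F).
Definition coprod : X := colim coprodColimit.
Definition inj (j : T) : F j ~> coprod := colim_leg coprodColimit j.
Definition cotuple (c : X) (k : forall j, F j ~> c) : coprod ~> c :=
  colim_desc coprodColimit (discreteCocone k).

Lemma cotupleE c (k : forall j, F j ~> c) j : cotuple k ∘ inj j = k j.
Proof. exact: (colim_fac coprodColimit (discreteCocone k) j). Qed.

Lemma coprod_ext c (f g : coprod ~> c) :
  (forall j, f ∘ inj j = g ∘ inj j) -> f = g.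
Proof. by move=> H; apply: (@colim_uniq _ _ _ coprodColimit). Qed.
End Coproducts.
Arguments coprod {X} XC {T} F.
Arguments inj {X} XC {T} F j.
Arguments cotuple {X} XC {T F c} k.

(* Two parallel morphisms, indexed by bool, from false to true. *)
Definition ppHom (x y : bool) : Type :=
  match x, y with
  | false, true => bool
  | true, false => void
  | _, _ => unit
  end.

Definition parallelPair : cat.
Proof.
refine (@Cat bool ppHom
  (fun x => match x return ppHom x x with true => tt | false => tt end)
  (fun x y z => match x, y, z
     return ppHom y z -> ppHom x y -> ppHom x z with
     | false, false, false => fun _ _ => tt
     | false, false, true => fun b _ => b
     | false, true, false => fun v _ => match v with end
     | false, true, true => fun _ b => b
     | true, false, false => fun _ v => v
     | true, false, true => fun _ v => match v with end
     | true, true, false => fun v _ => v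
     | true, true, true => fun _ _ => tt
     end) _ _ _).
- by case; case=> //; case.
- by case; case=> //; case.
- by case; case; case; case=> //; (try by case); move=> h; case=> //; case.
Defined.

Lemma parallelPair_countable : countableCat parallelPair.
Proof.
split=> [|x y]; first by exists nat_of_bool; case; case.
case: x y => [] [].
- by exists (fun=> 0); case; case.
- by exists (fun=> 0); case.
- by exists nat_of_bool; case; case.
- by exists (fun=> 0); case; case.
Qed.

Section Coequalizers.
Variables (X : cat) (XC : countablyCocomplete X) (x y : X) (f g : x ~> y).

Definition ppFunctor : functor parallelPair X.
Proof.
refine (@Functor parallelPair X (fun b => if b then y else x)
  (fun i j => match i, j return
      ppHom i j -> (if i then y else x) ~> (if j then y else x) with
     | false, false => fun _ => idm x
     | false, true => fun b => if b then g else f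
     | true, false => fun v => match v with end
     | true, true => fun _ => idm y
     end) _ _).
- by case.
- by case; case; case=> //= ? ?; rewrite ?comp1m ?compm1 //; case: (_ : void).
Defined.

Definition ppCocone (c : X) (k : y ~> c) (e : k ∘ f = k ∘ g) :
  cocone ppFunctor c.
Proof.
refine (@Cocone _ _ ppFunctor c
  (fun b => match b return (if b then y else x) ~> c with
            | true => k | false => k ∘ f end) _).
by case; case=> //=; rewrite ?compm1 //; case.
Defined.

Definition coeqColimit : colimit ppFunctor :=
  XC parallelPair_countable ppFunctor.
Definition coeq : X := colim coeqColimit.
Definition coeqMap : y ~> coeq := colim_leg coeqColimit true.
Definition coeqDesc (c : X) (k : y ~> c) (e : k ∘ f = k ∘ g) : coeq ~> c :=
  colim_desc coeqColimit (ppCocone e).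

Lemma coeqMapE : coeqMap ∘ f = coeqMap ∘ g.
Proof.
have Ef := legE (colim_leg coeqColimit) (false : ppHom false true).
have Eg := legE (colim_leg coeqColimit) (true : ppHom false true).
by rewrite /= in Ef Eg; rewrite /coeqMap Ef Eg.
Qed.

Lemma coeqDescE c (k : y ~> c) (e : k ∘ f = k ∘ g) : coeqDesc e ∘ coeqMap = k.
Proof. exact: (colim_fac coeqColimit (ppCocone e) true). Qed.

Lemma coeq_ext c (h h' : coeq ~> c) : h ∘ coeqMap = h' ∘ coeqMap -> h = h'.
Proof.
move=> E; apply: (@colim_uniq _ _ _ coeqColimit); case; first exact: E.
have Ef := legE (colim_leg coeqColimit) (false : ppHom false true).
rewrite -Ef /= !compA; exact: (congr1 (fun u => u ∘ f) E).
Qed.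
End Coequalizers.

(* The operations of a symmetric monoidal category, without the axioms.     *)
Record monCat := MonCat {
  mon_cat :> cat;
  tob : mon_cat -> mon_cat -> mon_cat;
  tmor : forall a b c d : mon_cat,
    a ~> c -> b ~> d -> tob a b ~> tob c d;
  one : mon_cat;
  asc : forall a b c, tob (tob a b) c ~> tob a (tob b c);
  ascV : forall a b c, tob a (tob b c) ~> tob (tob a b) c;
  lun : forall a, tob one a ~> a;
  lunV : forall a, a ~> tob one a;
  run : forall a, tob a one ~> a;
  runV : forall a, a ~> tob a one;
  brd : forall a b, tob a b ~> tob b a }.
Notation "x ⊗ y" := (tob x y) : cat_scope.
Notation "f ⊠ g" := (tmor f g) : cat_scope.
Arguments one {m}.
Arguments asc {m} a b c.
Arguments ascV {m} a b c.
Arguments lun {m} a.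
Arguments lunV {m} a.
Arguments run {m} a.
Arguments runV {m} a.
Arguments brd {m} a b.

Record monNatural (M : monCat) : Prop := {
  tmor_id : forall a b : M, idm a ⊠ idm b = idm (a ⊗ b);
  tmor_comp : forall (a b c a' b' c' : M) (g : b ~> c) (f : a ~> b)
    (g' : b' ~> c') (f' : a' ~> b'),
    (g ∘ f) ⊠ (g' ∘ f') = (g ⊠ g') ∘ (f ⊠ f');
  asc_nat : forall (a b c a' b' c' : M) (f : a ~> a') (g : b ~> b')
    (h : c ~> c'),
    asc a' b' c' ∘ ((f ⊠ g) ⊠ h) = (f ⊠ (g ⊠ h)) ∘ asc a b c;
  lun_nat : forall (a a' : M) (f : a ~> a'),
    lun a' ∘ (idm one ⊠ f) = f ∘ lun a;
  run_nat : forall (a a' : M) (f : a ~> a'),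
    run a' ∘ (f ⊠ idm one) = f ∘ run a;
  brd_nat : forall (a b a' b' : M) (f : a ~> a') (g : b ~> b'),
    brd a' b' ∘ (f ⊠ g) = (g ⊠ f) ∘ brd a b }.

Record monCoherent (M : monCat) : Prop := {
  ascK : forall a b c : M, ascV a b c ∘ asc a b c = idm _;
  ascVK : forall a b c : M, asc a b c ∘ ascV a b c = idm _;
  lunK : forall a : M, lunV a ∘ lun a = idm _;
  lunVK : forall a : M, lun a ∘ lunV a = idm _;
  runK : forall a : M, runV a ∘ run a = idm _;
  runVK : forall a : M, run a ∘ runV a = idm _;
  pentagon : forall a b c d : M,
    asc a b (c ⊗ d) ∘ asc (a ⊗ b) c d
    = (idm a ⊠ asc b c d) ∘ asc a (b ⊗ c) d ∘ (asc a b c ⊠ idm d);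
  triangle : forall a b : M, (idm a ⊠ lun b) ∘ asc a one b = run a ⊠ idm b;
  hexagon : forall a b c : M,
    asc b c a ∘ brd a (b ⊗ c) ∘ asc a b c
    = (idm b ⊠ brd a c) ∘ asc b a c ∘ (brd a b ⊠ idm c);
  brdK : forall a b : M, brd b a ∘ brd a b = idm (a ⊗ b) }.

Record smCat := SmCat {
  sm_mon :> monCat;
  sm_nat : monNatural sm_mon;
  sm_coh : monCoherent sm_mon }.

Record csmCat := CsmCat {
  csm_sm :> smCat;
  ihom : csm_sm -> csm_sm -> csm_sm;
  ev : forall x y, ihom x y ⊗ x ~> y;
  curry : forall z x y : csm_sm, z ⊗ x ~> y -> z ~> ihom x y;
  curryK : forall z x y (f : z ⊗ x ~> y), ev x y ∘ (curry f ⊠ idm x) = f;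
  curry_uniq : forall z x y (g : z ~> ihom x y),
    curry (ev x y ∘ (g ⊠ idm x)) = g }.
Arguments ihom {c} x y.
Arguments ev {c} x y.

Definition uncurry (V : csmCat) (z x y : V) (g : z ~> ihom x y) : z ⊗ x ~> y :=
  ev x y ∘ (g ⊠ idm x).

Definition mid (M : monCat) (a b c d : M) :
    (a ⊗ b) ⊗ (c ⊗ d) ~> (a ⊗ c) ⊗ (b ⊗ d) :=
  ascV a c (b ⊗ d) ∘ (idm a ⊠ (asc c b d ∘ (brd b c ⊠ idm d) ∘ ascV b c d))
  ∘ asc a b (c ⊗ d).
Arguments mid {M} a b c d.

(* X(s_1) ⊗ (X(s_2) ⊗ ... ⊗ (X(s_n) ⊗ 1)) *)
Fixpoint bigT (M : monCat) (J : Type) (X : J -> M) (s : seq J) : M :=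
  if s is j :: s' then X j ⊗ bigT X s' else one.

Section BigT.
Variables (M : monCat) (J : Type).
Implicit Types (X : J -> M) (s : seq J).

Fixpoint bigT_split X s1 s2 :
    bigT X (s1 ++ s2) ~> bigT X s1 ⊗ bigT X s2 :=
  match s1 with
  | [::] => lunV (bigT X s2)
  | j :: s => ascV (X j) (bigT X s) (bigT X s2) ∘ (idm (X j) ⊠ bigT_split X s s2)
  end.

Fixpoint bigT_join X s1 s2 :
    bigT X s1 ⊗ bigT X s2 ~> bigT X (s1 ++ s2) :=
  match s1 with
  | [::] => lun (bigT X s2)
  | j :: s => (idm (X j) ⊠ bigT_join X s s2) ∘ asc (X j) (bigT X s) (bigT X s2)
  end.

Definition bigT_swap X s1 s2 : bigT X (s1 ++ s2) ~> bigT X (s2 ++ s1) :=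
  bigT_join X s2 s1 ∘ brd (bigT X s1) (bigT X s2) ∘ bigT_split X s1 s2.

(* The unique rotation taking s to rot n s. *)
Definition bigT_unrot X n s : bigT X (rot n s) ~> bigT X s :=
  tr (congr1 (bigT X) (cat_take_drop n s)) ∘ bigT_swap X (drop n s) (take n s).

Lemma bigT_relabel_eq K X (Y : K -> M) s (l : seq K) :
  map X s = map Y l -> bigT X s = bigT Y l.
Proof.
by elim: s l => [|j s IH] [|k l] //= [-> /IH ->].
Qed.

Definition relabel K X (Y : K -> M) s (l : seq K) (e : map X s = map Y l) :
  bigT X s ~> bigT Y l := tr (bigT_relabel_eq e).
End BigT.

(* The tensor product of the morphisms a j : K_j ⊗ (⊗_{l in Xs j} X_l) ->   *)
(* Y_j, for j in js, preceded by the shuffle that brings the factors K_j in *)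
(* front.                                                                   *)
Fixpoint par (M : monCat) (J L : Type) (K : J -> M) (X : L -> M)
    (Xs : J -> seq L) (Y : J -> M)
    (a : forall j, K j ⊗ bigT X (Xs j) ~> Y j) (js : seq J) :
  bigT K js ⊗ bigT X (flatten (map Xs js)) ~> bigT Y js :=
  match js with
  | [::] => lun one
  | j :: js' =>
      (a j ⊠ par a js')
      ∘ mid (K j) (bigT K js') (bigT X (Xs j)) (bigT X (flatten (map Xs js')))
      ∘ (idm (K j ⊗ bigT K js')
           ⊠ bigT_split X (Xs j) (flatten (map Xs js')))
  end.

Record ecatData (V : monCat) := EcatData {
  eob :> Type;
  ehom : eob -> eob -> V;
  eid : forall x, one ~> ehom x x;
  ecomp : forall x y z, ehom y z ⊗ ehom x y ~> ehom x z }.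
Arguments ehom {V e} x y.
Arguments eid {V e} x.
Arguments ecomp {V e} x y z.

Record ecatLaws (V : monCat) (D : ecatData V) : Prop := {
  ecompA : forall x y z w : D,
    ecomp x y w ∘ (ecomp y z w ⊠ idm (ehom x y))
    = ecomp x z w ∘ (idm (ehom z w) ⊠ ecomp x y z) ∘ asc _ _ _;
  ecomp1m : forall x y : D, ecomp x y y ∘ (eid y ⊠ idm (ehom x y)) = lun _;
  ecompm1 : forall x y : D, ecomp x x y ∘ (idm (ehom x y) ⊠ eid x) = run _ }.

Record ecat (V : monCat) := Ecat {
  ecat_data :> ecatData V;
  ecat_laws : ecatLaws ecat_data }.

Definition emor (V : monCat) (D : ecatData V) (x y : D) : Type :=
  one ~> ehom x y.

Section Underlying.
Variables (V : monCat) (D : ecatData V).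
Implicit Types x y z : D.

Definition ecompm x y z (g : emor y z) (f : emor x y) : emor x z :=
  ecomp x y z ∘ (g ⊠ f) ∘ lunV one.
Definition epost x y z (g : emor y z) : ehom x y ~> ehom x z :=
  ecomp x y z ∘ (g ⊠ idm (ehom x y)) ∘ lunV (ehom x y).
Definition epre x y z (f : emor x y) : ehom y z ~> ehom x z :=
  ecomp x y z ∘ (idm (ehom y z) ⊠ f) ∘ runV (ehom y z).
End Underlying.
Arguments epost {V D} x {y z} g.
Arguments epre {V D x y} z f.

Definition eop (V : monCat) (K : ecatData V) : ecatData V :=
  @EcatData V K (fun x y => ehom y x) (fun x => eid x)
    (fun x y z => ecomp z y x ∘ brd (ehom z y) (ehom y x)).

Record efunctorData (V : monCat) (K L : ecatData V) := EfunctorData {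
  efob :> K -> L;
  efmor : forall x y : K, ehom x y ~> ehom (efob x) (efob y) }.
Arguments efmor {V K L} e x y.

Record efunctorLaws (V : monCat) (K L : ecatData V) (F : efunctorData K L)
    : Prop := {
  efmor_id : forall x, efmor F x x ∘ eid x = eid (F x);
  efmor_comp : forall x y z,
    efmor F x z ∘ ecomp x y z
    = ecomp (F x) (F y) (F z) ∘ (efmor F y z ⊠ efmor F x y) }.

Record efunctor (V : monCat) (K L : ecatData V) := Efunctor {
  efun_data :> efunctorData K L;
  efun_laws : efunctorLaws efun_data }.

(* Naturality only involves the operations, not the axioms they satisfy, of *)
(* the categories and functors concerned.                                   *)
Record enat (V : monCat) (K L : ecatData V) (F G : efunctorData K L) := Enat {
  ecpt :> forall x : K, emor (F x) (G x);
  ecpt_nat : forall x y : K,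
    epost (F x) (ecpt y) ∘ efmor F x y = epre (G y) (ecpt x) ∘ efmor G x y }.

Section Coherence.
Variable V : smCat.
Implicit Types a b c d : V.
Let N := sm_nat V.
Let H := sm_coh V.

Lemma tmor_compl a b c d (g : b ~> c) (f : a ~> b) :
  (g ∘ f) ⊠ idm d = (g ⊠ idm d) ∘ (f ⊠ idm d).
Proof. by rewrite -(tmor_comp N) comp1m. Qed.

Lemma tmor_compr a b c d (g : b ~> c) (f : a ~> b) :
  idm d ⊠ (g ∘ f) = (idm d ⊠ g) ∘ (idm d ⊠ f).
Proof. by rewrite -(tmor_comp N) comp1m. Qed.

Lemma tmor_lr a b c d (f : a ~> b) (g : c ~> d) :
  (f ⊠ idm d) ∘ (idm a ⊠ g) = f ⊠ g.
Proof. by rewrite -(tmor_comp N) comp1m compm1. Qed.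

Lemma tmor_rl a b c d (f : a ~> b) (g : c ~> d) :
  (idm b ⊠ g) ∘ (f ⊠ idm c) = f ⊠ g.
Proof. by rewrite -(tmor_comp N) comp1m compm1. Qed.

Lemma tcomp (a b c a' b' c' : V) (g : b ~> c) (f : a ~> b)
    (g' : b' ~> c') (f' : a' ~> b') :
  (g ⊠ g') ∘ (f ⊠ f') = (g ∘ f) ⊠ (g' ∘ f').
Proof. by rewrite (tmor_comp N). Qed.

Lemma tcompk (a b c a' b' c' d : V) (g : b ~> c) (f : a ~> b)
    (g' : b' ~> c') (f' : a' ~> b') (k : d ~> a ⊗ a') :
  (g ⊠ g') ∘ ((f ⊠ f') ∘ k) = ((g ∘ f) ⊠ (g' ∘ f')) ∘ k.
Proof. by rewrite compA tcomp. Qed.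

Definition tE := (tcomp, tcompk).

Lemma lunV_nat a b (f : a ~> b) : (idm one ⊠ f) ∘ lunV a = lunV b ∘ f.
Proof.
rewrite -[LHS]comp1m -(lunK H) -!compA; congr (_ ∘ _).
by rewrite compA (lun_nat N) -compA (lunVK H) compm1.
Qed.

Lemma runV_nat a b (f : a ~> b) : (f ⊠ idm one) ∘ runV a = runV b ∘ f.
Proof.
rewrite -[LHS]comp1m -(runK H) -!compA; congr (_ ∘ _).
by rewrite compA (run_nat N) -compA (runVK H) compm1.
Qed.

Lemma ascV_nat a b c a' b' c' (f : a ~> a') (g : b ~> b') (h : c ~> c') :
  ascV a' b' c' ∘ (f ⊠ (g ⊠ h)) = ((f ⊠ g) ⊠ h) ∘ ascV a b c.
Proof.
rewrite -[RHS]comp1m -(ascK H) -!compA; congr (_ ∘ _).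
by rewrite !compA (asc_nat N) -compA (ascVK H) compm1.
Qed.

Lemma one_tmor_inj a b (f g : a ~> b) : idm one ⊠ f = idm one ⊠ g -> f = g.
Proof.
move=> E; rewrite -[f]compm1 -(lunVK H) compA -(lun_nat N) E (lun_nat N).
by rewrite -compA (lunVK H) compm1.
Qed.

Lemma tmor_one_inj a b (f g : a ~> b) : f ⊠ idm one = g ⊠ idm one -> f = g.
Proof.
move=> E; rewrite -[f]compm1 -(runVK H) compA -(run_nat N) E (run_nat N).
by rewrite -compA (runVK H) compm1.
Qed.

Lemma lunV_natk a b c (f : a ~> b) (k : c ~> a) :
  lunV b ∘ (f ∘ k) = (idm one ⊠ f) ∘ (lunV a ∘ k).
Proof. by rewrite !compA lunV_nat. Qed.

Lemma runV_natk a b c (f : a ~> b) (k : c ~> a) :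
  runV b ∘ (f ∘ k) = (f ⊠ idm one) ∘ (runV a ∘ k).
Proof. by rewrite !compA runV_nat. Qed.

Lemma asc_natk (a b c a' b' c' d : V) (f : a ~> a') (g : b ~> b')
    (h : c ~> c') (k : d ~> (a ⊗ b) ⊗ c) :
  asc a' b' c' ∘ (((f ⊠ g) ⊠ h) ∘ k) = (f ⊠ (g ⊠ h)) ∘ (asc a b c ∘ k).
Proof. by rewrite !compA (asc_nat N). Qed.

Lemma asc_epi a b c d (f g : a ⊗ (b ⊗ c) ~> d) :
  f ∘ asc a b c = g ∘ asc a b c -> f = g.
Proof.
by move=> E; rewrite -[f]compm1 -(ascVK H) compA E -compA (ascVK H) compm1.
Qed.

Lemma asc_mono a b c d (f g : d ~> (a ⊗ b) ⊗ c) :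
  asc a b c ∘ f = asc a b c ∘ g -> f = g.
Proof.
by move=> E; rewrite -[f]comp1m -(ascK H) -compA E compA (ascK H) comp1m.
Qed.

Lemma lun_asc a b : lun (a ⊗ b) ∘ asc one a b = lun a ⊠ idm b.
Proof.
apply: one_tmor_inj; apply: asc_epi.
have -> : (idm one ⊠ (lun a ⊠ idm b)) ∘ asc one (one ⊗ a) b
  = asc one a b ∘ ((idm one ⊠ lun a) ⊠ idm b) by rewrite (asc_nat N).
have inv c (f g : (one ⊗ (one ⊗ a)) ⊗ b ~> c) :
  f ∘ (asc one one a ⊠ idm b) = g ∘ (asc one one a ⊠ idm b) -> f = g.
  move=> e; rewrite -[f]compm1 -[g]compm1 -(tmor_id N) -(ascVK H) tmor_compl.
  by rewrite !compA e.
apply: inv; rewrite -[RHS]compA -tmor_compl (triangle H).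
rewrite tmor_compr -!compA -(pentagon H) compA (triangle H).
by rewrite (asc_nat N) (tmor_id N).
Qed.

Lemma run_asc a b : (idm a ⊠ run b) ∘ asc a b one = run (a ⊗ b).
Proof.
apply: tmor_one_inj; apply: asc_mono.
rewrite -(triangle H) tmor_compl [LHS]compA (asc_nat N) -(triangle H).
rewrite tmor_compr -!compA -(pentagon H) !compA -(tmor_id N).
by rewrite (asc_nat N).
Qed.

Lemma lun_one : lun one = run one :> (one ⊗ one ~> (one : V)).
Proof.
have E : lun (one ⊗ one) = idm one ⊠ lun (one : V).
  by rewrite -[LHS]comp1m -[RHS]comp1m -(lunK H) -!compA (lun_nat N).
by apply: tmor_one_inj; rewrite -lun_asc -(triangle H) E.
Qed.

Lemma lunV_one : lunV one = runV one :> (one ~> (one : V) ⊗ one).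
Proof. by rewrite -[LHS]compm1 -(runVK H) -lun_one compA (lunK H) comp1m. Qed.

Lemma asc_lunV a b : asc one a b ∘ (lunV a ⊠ idm b) = lunV (a ⊗ b).
Proof.
rewrite -[LHS]comp1m -(lunK H) -!compA (compA (lun _)) lun_asc.
by rewrite -tmor_compl (lunVK H) (tmor_id N) compm1.
Qed.

Lemma asc_runV a b : asc a b one ∘ runV (a ⊗ b) = idm a ⊠ runV b.
Proof.
rewrite -[LHS]comp1m -(tmor_id N) -(runK H) tmor_compr -!compA.
by rewrite [_ ∘ (asc _ _ _ ∘ _)]compA run_asc (runVK H) compm1.
Qed.

Lemma asc_mid a b : asc a one b ∘ (runV a ⊠ idm b) = idm a ⊠ lunV b.
Proof.
rewrite -[LHS]comp1m -(tmor_id N) -(lunK H) tmor_compr -!compA.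
rewrite [_ ∘ (asc _ _ _ ∘ _)]compA (triangle H) -tmor_compl (runVK H).
by rewrite (tmor_id N) compm1.
Qed.
End Coherence.

Section EnrichedHom.
Variables (V : smCat) (D : ecat V).
Implicit Types x y z w : D.
Let N := sm_nat V.
Let H := sm_coh V.
Let L := ecat_laws D.

Lemma epost_comp x y z w (g : emor z w) (f : emor y z) :
  epost x (ecompm g f) = epost x g ∘ epost x f.
Proof.
rewrite /epost /ecompm !tmor_compl !compA (ecompA L) -!compA; congr (_ ∘ _).
rewrite asc_natk (compA (asc _ _ _)) lunV_one asc_mid.
rewrite !lunV_natk !tE !comp1m !compm1.
by rewrite -lunV_nat tE compm1.
Qed.

Lemma ecompAk x y z w c d e f (h : c ~> ehom z w) (g : d ~> ehom y z)
    (k : e ~> ehom x y) (u : f ~> (c ⊗ d) ⊗ e) :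
  ecomp x y w ∘ (((ecomp y z w ∘ (h ⊠ g)) ⊠ k) ∘ u)
  = ecomp x z w ∘ ((h ⊠ (ecomp x y z ∘ (g ⊠ k))) ∘ (asc c d e ∘ u)).
Proof.
rewrite -[k in LHS]comp1m -tcomp -!compA (compA (ecomp _ _ _)) (ecompA L).
by rewrite -!compA asc_natk tcompk comp1m.
Qed.

Lemma epre_comp x y z w (g : emor y z) (f : emor x y) :
  epre w (ecompm g f) = epre w f ∘ epre w g.
Proof.
rewrite /epre /ecompm -!compA !runV_natk !tE !comp1m !compm1.
rewrite ecompAk (compA (asc _ _ _)) asc_runV tcompk comp1m lunV_one.
by rewrite -!compA.
Qed.

Lemma epost_epre x y z w (g : emor z w) (f : emor x y) :
  epost x g ∘ epre z f = epre w f ∘ epost y g.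
Proof.
rewrite /epre /epost -!compA !runV_natk !lunV_natk !tE !comp1m !compm1.
rewrite ecompAk (compA (asc _ _ _)) asc_runV -lunV_nat !tcompk.
by rewrite !compm1 -!compA.
Qed.

Lemma epost_ecomp x y z w (g : emor z w) :
  ecomp x y w ∘ (epost y g ⊠ idm (ehom x y)) = epost x g ∘ ecomp x y z.
Proof.
rewrite /epost !tmor_compl -!compA (compA (ecomp _ _ _)) (ecompA L) -!compA.
rewrite asc_natk asc_lunV tcompk comp1m (tmor_id N) compm1 -lunV_nat.
by rewrite tcompk compm1 comp1m.
Qed.

Lemma ecompm1m x y (f : emor x y) : ecompm (eid y) f = f.
Proof.
rewrite /ecompm -tmor_lr -!compA lunV_nat compA (ecomp1m L).
by rewrite compA (lunVK H) comp1m.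
Qed.

Lemma ecompmm1 x y (f : emor x y) : ecompm f (eid x) = f.
Proof.
rewrite /ecompm lunV_one -tmor_rl -!compA runV_nat compA (ecompm1 L).
by rewrite compA (runVK H) comp1m.
Qed.

Lemma ecompmA x y z w (h : emor z w) (g : emor y z) (f : emor x y) :
  ecompm h (ecompm g f) = ecompm (ecompm h g) f.
Proof.
rewrite /ecompm -{2}[f]compm1 !compA -[in RHS]tcomp -!compA ecompAk.
rewrite (compA (asc _ _ _)) lunV_one asc_mid -lunV_one tcompk compm1.
by rewrite -!compA.
Qed.

End EnrichedHom.

Definition und (V : smCat) (D : ecat V) : cat :=
  @Cat D (@emor V D) (fun x => eid x) (@ecompm V D)
    (@ecompm1m V D) (@ecompmm1 V D) (@ecompmA V D).

Section Self.
Variable V : csmCat.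
Implicit Types x y z w : V.
Let N := sm_nat V.
Let H := sm_coh V.

Lemma uncurry_comp x y z w (g : z ~> ihom x y) (f : w ~> z) :
  uncurry (g ∘ f) = uncurry g ∘ (f ⊠ idm x).
Proof. by rewrite /uncurry tmor_compl compA. Qed.

Lemma uncurryK x y z (g : z ~> ihom x y) : curry (uncurry g) = g.
Proof. exact: curry_uniq. Qed.

Lemma curryE x y z (f : z ⊗ x ~> y) : uncurry (curry f) = f.
Proof. exact: curryK. Qed.

Lemma uncurry_inj x y z (f g : z ~> ihom x y) : uncurry f = uncurry g -> f = g.
Proof. by move=> E; rewrite -[f]uncurryK E uncurryK. Qed.

Definition selfData : ecatData V := @EcatData V V (@ihom V)
  (fun x => curry (lun x))
  (fun x y z =>
     curry (ev y z ∘ (idm (ihom y z) ⊠ ev x y) ∘ asc (ihom y z) (ihom x y) x)).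

Lemma uncurry_ecomp x y z c d (g : c ~> ihom y z) (f : d ~> ihom x y) :
  uncurry (ecomp (e := selfData) x y z ∘ (g ⊠ f))
  = uncurry g ∘ (idm c ⊠ uncurry f) ∘ asc c d x.
Proof.
rewrite uncurry_comp curryE /uncurry -!compA (asc_nat N) !tE.
by rewrite !comp1m !compm1.
Qed.

Lemma uncurry_id x y : uncurry (idm (ihom x y)) = ev x y.
Proof. by rewrite /uncurry (tmor_id N) compm1. Qed.

Lemma selfLaws : ecatLaws selfData.
Proof.
split=> [x y z w|x y|x y]; apply: uncurry_inj.
- rewrite uncurry_ecomp [in RHS]compA [in RHS]uncurry_comp uncurry_ecomp.
  rewrite !curryE !uncurry_id -(tmor_id N) -!compA asc_natk (pentagon H).
  by rewrite !tE !comp1m.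
- by rewrite uncurry_ecomp uncurry_id curryE compA (lun_nat N) -compA lun_asc.
- by rewrite uncurry_ecomp uncurry_id curryE (triangle H).
Qed.

Definition self : ecat V := Ecat selfLaws.

Lemma uncurry_epost x y z (u : y ~> z) :
  uncurry (epost (D := self) x (curry (u ∘ lun y))) = u ∘ ev x y.
Proof.
rewrite /epost compA uncurry_comp uncurry_ecomp curryE uncurry_id -!compA.
by rewrite asc_lunV (compA (lun _)) (lun_nat N) -compA (lunVK H) compm1.
Qed.

Lemma uncurry_epre x y z (u : x ~> y) :
  uncurry (epre (D := self) z (curry (u ∘ lun x))) = ev y z ∘ (idm _ ⊠ u).
Proof.
rewrite /epre compA uncurry_comp uncurry_ecomp curryE uncurry_id -!compA.
by rewrite asc_mid tcomp comp1m -compA (lunVK H) compm1.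
Qed.
End Self.

Record smecatData (V : smCat) := SmecatData {
  sme_cat :> ecat V;
  eten : sme_cat -> sme_cat -> sme_cat;
  etenm : forall a b c d : sme_cat,
    ehom a c ⊗ ehom b d ~> ehom (eten a b) (eten c d);
  eone : sme_cat;
  easc : forall a b c, emor (eten (eten a b) c) (eten a (eten b c));
  eascV : forall a b c, emor (eten a (eten b c)) (eten (eten a b) c);
  elun : forall a, emor (eten eone a) a;
  elunV : forall a, emor a (eten eone a);
  erun : forall a, emor (eten a eone) a;
  erunV : forall a, emor a (eten a eone);
  ebrd : forall a b, emor (eten a b) (eten b a) }.
Arguments etenm {V s} a b c d.

Definition undM (V : smCat) (D : smecatData V) : monCat :=
  @MonCat (und D) (@eten V D)
    (fun a b c d f g => etenm a b c d ∘ (f ⊠ g) ∘ lunV one) (eone D)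
    (@easc V D) (@eascV V D) (@elun V D) (@elunV V D) (@erun V D) (@erunV V D)
    (@ebrd V D).

(* The tensor product is a V-functor and the structure morphisms are        *)
(* V-natural.                                                               *)
Record smecatLaws (V : smCat) (D : smecatData V) : Prop := {
  etenm_id : forall a b : D,
    etenm a b a b ∘ (eid a ⊠ eid b) ∘ lunV one = eid (eten a b);
  etenm_comp : forall a b c a' b' c' : D,
    etenm a a' c c' ∘ (ecomp a b c ⊠ ecomp a' b' c')
    = ecomp _ _ _ ∘ (etenm b b' c c' ⊠ etenm a a' b b')
      ∘ mid (ehom b c) (ehom a b) (ehom b' c') (ehom a' b');
  easc_nat : forall a b c a' b' c' : D,
    epost _ (easc a' b' c') ∘ etenm (eten a b) c (eten a' b') c'
      ∘ (etenm a b a' b' ⊠ idm (ehom c c'))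
    = epre _ (easc a b c) ∘ etenm a (eten b c) a' (eten b' c')
      ∘ (idm (ehom a a') ⊠ etenm b c b' c') ∘ asc _ _ _;
  elun_nat : forall a a' : D,
    epost _ (elun a') ∘ etenm (eone D) a (eone D) a'
      ∘ (eid (eone D) ⊠ idm (ehom a a')) ∘ lunV (ehom a a')
    = epre a' (elun a);
  erun_nat : forall a a' : D,
    epost _ (erun a') ∘ etenm a (eone D) a' (eone D)
      ∘ (idm (ehom a a') ⊠ eid (eone D)) ∘ runV (ehom a a')
    = epre a' (erun a);
  ebrd_nat : forall a b a' b' : D,
    epost _ (ebrd a' b') ∘ etenm a b a' b'
    = epre _ (ebrd a b) ∘ etenm b a b' a' ∘ brd (ehom a a') (ehom b b');
  undM_coh : monCoherent (undM D) }.

Record smecat (V : smCat) := Smecat {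
  sme_data :> smecatData V;
  sme_laws : smecatLaws sme_data }.

(* Internal hom, tensors and cotensors are given by their universal         *)
(* morphisms; the isomorphisms they induce on hom objects are V-natural by  *)
(* construction.  Compatibility of tensors with the tensor product of D, as *)
(* in K ⊗ (X ⊗ Y) = (K ⊗ X) ⊗ Y, is a consequence, since the V-functor      *)
(* - ⊗ Y has a right V-adjoint.                                             *)
Record csmecat (V : csmCat) := Csmecat {
  csme_sm :> smecat V;
  eihom : csme_sm -> csme_sm -> csme_sm;
  eev : forall x y : csme_sm, emor (eten (eihom x y) x) y;
  eihomP : forall x y z : csme_sm,
    isIso (epost _ (eev x y) ∘ etenm z x (eihom x y) x
             ∘ (idm (ehom z (eihom x y)) ⊠ eid x) ∘ runV _);
  etens : V -> csme_sm -> csme_sm;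
  etensU : forall k (x : csme_sm), k ~> ehom x (etens k x);
  etensP : forall k (x y : csme_sm),
    isIso (curry (ecomp x (etens k x) y
                    ∘ (idm (ehom (etens k x) y) ⊠ etensU k x)));
  ecot : V -> csme_sm -> csme_sm;
  ecotU : forall k (x : csme_sm), k ~> ehom (ecot k x) x;
  ecotP : forall k (x y : csme_sm),
    isIso (curry (ecomp y (ecot k x) x
                    ∘ (ecotU k x ⊠ idm (ehom y (ecot k x)))
                    ∘ brd (ehom y (ecot k x)) k)) }.
Arguments etensU {V c} k x.
Notation "k ⊙ x" := (etens k x) (at level 40, left associativity) : cat_scope.

Section Tensored.
Variables (V : csmCat) (D : csmecat V).

Definition transpose (k : V) (x y : D) (f : emor (k ⊙ x) y) : k ~> ehom x y :=
  epost x f ∘ etensU k x.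
Definition untranspose (k : V) (x y : D) (g : k ~> ehom x y) : emor (k ⊙ x) y :=
  isoV (etensP k x y) ∘ curry (g ∘ lun k).

Lemma transposeE (k : V) (x y : D) (f : emor (k ⊙ x) y) :
  uncurry (curry (ecomp x (k ⊙ x) y ∘ (idm (ehom (k ⊙ x) y) ⊠ etensU k x)) ∘ f)
  = transpose f ∘ lun k.
Proof.
rewrite uncurry_comp curryE /transpose /epost -!compA; congr (_ ∘ _).
rewrite lunV_natk (lunK (sm_coh V)) compm1.
by rewrite !tE !comp1m !compm1.
Qed.

Lemma transposeK (k : V) (x y : D) (f : emor (k ⊙ x) y) :
  untranspose (transpose f) = f.
Proof.
rewrite /untranspose -transposeE uncurryK compA.
by rewrite (isoVK (etensP k x y)) comp1m.
Qed.

Lemma untransposeK (k : V) (x y : D) (g : k ~> ehom x y) :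
  transpose (untranspose g) = g.
Proof.
rewrite -[LHS]compm1 -(lunVK (sm_coh V)) compA -transposeE /untranspose.
rewrite (compA (curry _)) (isoKV (etensP k x y)) comp1m curryE.
by rewrite -compA (lunVK (sm_coh V)) compm1.
Qed.

Fixpoint epar (J L : Type) (K : J -> V) (X : L -> undM D)
    (Xs : J -> seq L) (Y : J -> undM D)
    (a : forall j, K j ~> ehom (bigT X (Xs j) : D) (Y j)) (js : seq J) :
  bigT K js ~> ehom (bigT X (flatten (map Xs js)) : D) (bigT Y js) :=
  match js with
  | [::] => eid (eone D)
  | j :: js' =>
      epre (D := D) _ (bigT_split X (Xs j) (flatten (map Xs js')))
      ∘ etenm _ _ _ _ ∘ (a j ⊠ epar a js')
  end.
End Tensored.

(* P(S) only depends on S up to its unique order isomorphism with           *)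
(* {1 < ... < n}, so an operad is given by its values P(n).  An             *)
(* order-preserving map is given by the list ns of the sizes of its fibers. *)
Record operadData (V : smCat) := OperadData {
  opd :> nat -> V;
  opd_unit : one ~> opd 1;
  opd_comp : forall ns : seq nat,
    opd (size ns) ⊗ bigT opd ns ~> opd (sumn ns) }.

(* The same composition for the fiber sizes n j, j in js, with its source   *)
(* and target transported along equalities of natural numbers.              *)
Definition opcomp (V : smCat) (P : operadData V) (J : Type) (n : J -> nat)
    (js : seq J) (k m : nat) (ek : k = size js) (em : sumn (map n js) = m) :
  P k ⊗ bigT (P \o n) js ~> P m :=
  tr (congr1 P em) ∘ opd_comp P (map n js)
  ∘ (tr (congr1 P (etrans ek (esym (size_map n js))))
       ⊠ relabel (map_comp P n js)).

Definition opunit (V : smCat) (P : operadData V) (n : nat) (e : 1 = n) :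
  one ~> P n := tr (congr1 P e) ∘ opd_unit P.

Fixpoint bigT_units (M : monCat) (J : Type) (X : J -> M)
    (u : forall j, one ~> X j) (js : seq J) : one ~> bigT X js :=
  match js with
  | [::] => idm one
  | j :: js' => (u j ⊠ bigT_units u js') ∘ lunV one
  end.

Lemma sumn_flatten_id (nss : seq (seq nat)) :
  sumn (map sumn nss) = sumn (flatten (map id nss)).
Proof. by rewrite map_id sumn_flatten. Qed.

Lemma size_flatten_id (T : Type) (ss : seq (seq T)) :
  sumn (map size ss) = size (flatten (map id ss)).
Proof. by rewrite map_id size_flatten. Qed.

Lemma sumn_ones (J : Type) (js : seq J) n :
  n = size js -> sumn (map (fun=> 1) js) = n.
Proof. by move->; elim: js => //= j js ->. Qed.

Record operadLaws (V : smCat) (P : operadData V) : Prop := {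
  opd_assoc : forall nss : seq (seq nat),
    opcomp (n := sumn) P erefl (sumn_flatten_id nss)
      ∘ (idm (P (size nss)) ⊠ par (Xs := id) (fun ns => opd_comp P ns) nss)
      ∘ asc _ _ _
    = opd_comp P (flatten (map id nss))
      ∘ (opcomp (n := size) P erefl (size_flatten_id nss) ⊠ idm _);
  opd_unitl : forall n,
    opcomp (n := id) (js := [:: n]) P erefl (addn0 n)
      ∘ (opd_unit P ⊠ runV (P n)) ∘ lunV (P n) = idm (P n);
  opd_unitr : forall n,
    let e := esym (size_nseq n tt) in
    opcomp (n := fun=> 1) P e (sumn_ones e)
      ∘ (idm (P n) ⊠ bigT_units (fun=> opd_unit P) (nseq n tt)) ∘ runV (P n)
    = idm (P n) }.

Record operad (V : smCat) := Operad {
  opd_data :> operadData V;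
  opd_laws : operadLaws opd_data }.

Section Algebras.
Variables (V : csmCat) (D : csmecat V) (P : operad V).

Definition tensL (s : seq D) : D := bigT (M := undM D) id s.

Definition actOn (k : V) (l : seq D) (y : D) (a : emor (k ⊙ tensL l) y)
    (J : Type) (X : J -> undM D) (s : seq J) (e : map X s = l) :
  k ~> ehom (bigT X s : D) y :=
  epre (D := D) y (relabel (M := undM D) (etrans e (esym (map_id l))))
  ∘ transpose a.

Record algebraData := AlgebraData {
  alg :> D;
  alg_act : forall n, emor (P n ⊙ tensL (nseq n alg)) alg }.

Lemma map_const (A : D) (J : Type) (s : seq J) :
  map (fun=> A) s = nseq (size s) A.
Proof. by elim: s => //= j s ->. Qed.

Lemma flatten_nseq (A : D) (ns : seq nat) :
  map id (flatten (map (fun n => nseq n A) ns)) = nseq (sumn ns) A.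
Proof. by rewrite map_id; elim: ns => //= n ns ->; rewrite nseqD. Qed.

(* The associativity diagram starts at (P(T) ⊗ P[f]) ⊗ A^S and ends at A.   *)
(* It is written in terms of the corresponding maps                         *)
(* P(T) ⊗ P[f] -> Hom(A^S, A).                                              *)
Record algebraLaws (A : algebraData) : Prop := {
  alg_assoc : forall ns : seq nat,
    actOn (alg_act A (sumn ns)) (flatten_nseq A ns) ∘ opd_comp P ns
    = ecomp _ _ _
      ∘ (actOn (alg_act A (size ns)) (map_const A ns)
           ⊠ epar (X := id) (Xs := fun n => nseq n (alg A))
               (fun n => transpose (alg_act A n)) ns);
  alg_unit : transpose (alg_act A 1) ∘ opd_unit P = erun (alg A) }.

Record algebra := Algebra {
  alg_data :> algebraData;
  alg_laws : algebraLaws alg_data }.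

Variable A : algebra.

(* bim_act i j is the structure map with M in position i + 1 of n = i + 1 + j. *)
Record bimoduleData := BimoduleData {
  bim :> D;
  bim_act : forall i j,
    emor (P (i + j).+1 ⊙ tensL (nseq i (alg A) ++ bim :: nseq j (alg A))) bim }.

Inductive cell := AlgCell of nat | BimCell of nat & nat.

Definition cellAr (c : cell) : nat :=
  match c with AlgCell n => n | BimCell i j => (i + j).+1 end.

Definition cellIn (M : D) (c : cell) : seq D :=
  match c with
  | AlgCell n => nseq n (alg A)
  | BimCell i j => nseq i (alg A) ++ M :: nseq j (alg A)
  end.

Definition cellOut (M : D) (c : cell) : D :=
  if c is AlgCell _ then alg A else M.

Definition cellAct (M : bimoduleData) (c : cell) :
    P (cellAr c) ~> ehom (tensL (cellIn M c)) (cellOut M c) :=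
  match c with
  | AlgCell n => transpose (alg_act A n)
  | BimCell i j => transpose (bim_act M i j)
  end.

Definition bimCells (ns1 : seq nat) i j (ns2 : seq nat) : seq cell :=
  map AlgCell ns1 ++ BimCell i j :: map AlgCell ns2.

Lemma bimCells_size ns1 i j ns2 :
  (size ns1 + size ns2).+1 = size (bimCells ns1 i j ns2).
Proof. by rewrite /bimCells size_cat /= !size_map addnS. Qed.

Lemma bimCells_ar ns1 i j ns2 :
  sumn (map cellAr (bimCells ns1 i j ns2))
  = ((sumn ns1 + i) + (j + sumn ns2)).+1.
Proof.
rewrite /bimCells map_cat sumn_cat /= -!map_comp.
by rewrite !(@eq_map _ _ (cellAr \o AlgCell) id) // !map_id addnS !addnA.
Qed.

Lemma bimCells_out (M : D) ns1 i j ns2 :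
  map (cellOut M) (bimCells ns1 i j ns2)
  = nseq (size ns1) (alg A) ++ M :: nseq (size ns2) (alg A).
Proof. by rewrite /bimCells map_cat /= -!map_comp !map_const. Qed.

Lemma bimCells_in (M : D) ns1 i j ns2 :
  map id (flatten (map (cellIn M) (bimCells ns1 i j ns2)))
  = nseq (sumn ns1 + i) (alg A) ++ M :: nseq (j + sumn ns2) (alg A).
Proof.
rewrite map_id /bimCells map_cat flatten_cat /= -!map_comp.
rewrite -[flatten _ in LHS]map_id flatten_nseq.
rewrite -[flatten (map (cellIn M \o AlgCell) ns2)]map_id flatten_nseq.
by rewrite !nseqD -!catA.
Qed.

(* An operation on A^p ⊗ M ⊗ A^q, p = size ns1, q = size ns2, applied to    *)
(* the results of operations on factors A^n, for n in ns1 and in ns2, and   *)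
(* of one operation on A^i ⊗ M ⊗ A^j.                                       *)
Record bimoduleLaws (M : bimoduleData) : Prop := {
  bim_assoc : forall ns1 i j ns2,
    actOn (bim_act M (sumn ns1 + i) (j + sumn ns2)) (bimCells_in M ns1 i j ns2)
      ∘ opcomp P (bimCells_size ns1 i j ns2) (bimCells_ar ns1 i j ns2)
    = ecomp _ _ _
      ∘ (actOn (bim_act M (size ns1) (size ns2)) (bimCells_out M ns1 i j ns2)
           ⊠ epar (X := id) (cellAct M) (bimCells ns1 i j ns2));
  bim_unit : transpose (bim_act M 0 0) ∘ opd_unit P = erun (bim M) }.

Record bimodule := Bimodule {
  bim_data :> bimoduleData;
  bim_laws : bimoduleLaws bim_data }.
End Algebras.

(* The object n is the set {0, ..., n} with basepoint 0 and its standard    *)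
(* cyclic order.  A morphism f from m to n is given by the lists fib f t of *)
(* the elements of the fibers over t, in their linear order.  Their         *)
(* concatenation has to be {0, ..., m} up to a rotation; in particular each *)
(* element lies in exactly one fiber, which determines the underlying map.  *)
Definition isDmor m n (fb : {ffun 'I_n.+1 -> seq 'I_m.+1}) : bool :=
  (ord0 \in fb ord0) &&
  [exists k : 'I_m.+1,
     flatten (map fb (enum 'I_n.+1)) == rot k (enum 'I_m.+1)].

Definition dmor m n : countType :=
  {fb : {ffun 'I_n.+1 -> seq 'I_m.+1} | isDmor fb}.
Definition fib m n (f : dmor m n) (t : 'I_n.+1) : seq 'I_m.+1 := val f t.

Definition cyc m n (f : dmor m n) : seq 'I_m.+1 :=
  flatten (map (fib f) (enum 'I_n.+1)).

Lemma fib0P m n (f : dmor m n) : ord0 \in fib f ord0.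
Proof. by case/andP: (valP f). Qed.

Lemma cyc_uniq m n (f : dmor m n) : uniq (cyc f).
Proof.
case/andP: (valP f) => _ /existsP[k /eqP E].
by rewrite /cyc E rot_uniq enum_uniq.
Qed.

Lemma fib_uniq m n (f : dmor m n) t : uniq (fib f t).
Proof.
have [s1 [s2 E]] : exists s1 s2, enum 'I_n.+1 = s1 ++ t :: s2.
  have /path.splitPr[s1 s2] := mem_enum 'I_n.+1 t.
  by exists s1, s2.
move: (cyc_uniq f).
by rewrite /cyc E map_cat flatten_cat /= !cat_uniq => /and3P[_ _ /and3P[]].
Qed.

Lemma cyc_rot m n (f : dmor m n) :
  rot (index ord0 (cyc f)) (cyc f) = enum 'I_m.+1.
Proof.
case/andP: (valP f) => _ /existsP[[k /= _] /eqP E]; rewrite /cyc {}E.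
have := enum_uniq 'I_m.+1; rewrite enum_ordSl.
case: k => [|k] /=; first by rewrite rot0 /= ?eqxx rot0.
case/andP=> h0 _; set l := map _ _ in h0 *.
have -> : rot k.+1 (ord0 :: l) = drop k l ++ ord0 :: take k l by [].
rewrite index_cat /= ?eqxx addn0 ifN; last by apply: contra h0 => /mem_drop.
by rewrite rot_size_cat /= cat_take_drop.
Qed.

Lemma rot_ord_ex m j : exists k : 'I_m.+1,
  rot j (enum 'I_m.+1) = rot k (enum 'I_m.+1).
Proof.
case: (ltnP j m.+1) => hj; first by exists (Ordinal hj).
by exists ord0; rewrite rot0 rot_oversize // size_enum_ord.
Qed.

Lemma rot_rot_ex (T : Type) (s : seq T) i j :
  exists k, rot i (rot j s) = rot k s.
Proof.
case: (leqP (size s) i) => hi.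
  by exists j; rewrite rot_oversize // size_rot.
case: (leqP (size s) j) => hj; first by exists i; rewrite (rot_oversize hj).
by eexists; apply: rot_add_mod; apply: ltnW.
Qed.

Lemma flatten_map_flatten (T U : Type) (F : T -> seq U) (ss : seq (seq T)) :
  flatten (map F (flatten ss)) = flatten (map (fun s => flatten (map F s)) ss).
Proof. by elim: ss => //= s ss <-; rewrite map_cat flatten_cat. Qed.

Lemma flatten_rot_ex (T U : Type) (F : T -> seq U) (s : seq T) k :
  exists j, flatten (map F (rot k s)) = rot j (flatten (map F s)).
Proof.
exists (size (flatten (map F (take k s)))).
rewrite -{3}(cat_take_drop k s) !map_cat !flatten_cat.
by rewrite rot_size_cat.
Qed.

Lemma dcomp_subproof m n p (g : dmor n p) (f : dmor m n) :
  isDmor [ffun u => flatten (map (fib f) (fib g u))].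
Proof.
apply/andP; split.
  by rewrite ffunE; apply/flatten_mapP; exists ord0; apply: fib0P.
apply/existsP.
have -> : flatten (map [ffun u => flatten (map (fib f) (fib g u))]
             (enum 'I_p.+1)) = flatten (map (fib f) (cyc g)).
  rewrite /cyc flatten_map_flatten -map_comp; congr flatten.
  by apply: eq_map => u; rewrite ffunE.
case/andP: (valP g) => _ /existsP[k /eqP E]; rewrite /cyc {}E.
have [j ->] := flatten_rot_ex (fib f) (enum 'I_n.+1) k.
case/andP: (valP f) => _ /existsP[i /eqP E]; rewrite /fib {}E.
have [l ->] := rot_rot_ex (enum 'I_m.+1) j i.
by have [q ->] := rot_ord_ex m l; exists q.
Qed.

Definition dcomp m n p (g : dmor n p) (f : dmor m n) : dmor m p :=
  Sub _ (dcomp_subproof g f).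

Lemma did_subproof n : isDmor [ffun t : 'I_n.+1 => [:: t]].
Proof.
apply/andP; split; first by rewrite ffunE mem_head.
apply/existsP; exists ord0; rewrite rot0; apply/eqP.
by rewrite (eq_map (ffunE _)) flatten_seq1.
Qed.

Definition did n : dmor n n := Sub _ (did_subproof n).

Lemma fib_did n (t : 'I_n.+1) : fib (did n) t = [:: t].
Proof. by rewrite /fib /= ffunE. Qed.

Lemma fib_dcomp m n p (g : dmor n p) (f : dmor m n) u :
  fib (dcomp g f) u = flatten (map (fib f) (fib g u)).
Proof. by rewrite /fib /= ffunE. Qed.

(* The isomorphism permuting the factors of a tensor product over the       *)
(* source of f into the order given by the fibers of f.                     *)
Definition cycT (M : monCat) m n (f : dmor m n) (X : 'I_m.+1 -> M) :
  bigT X (enum 'I_m.+1) ~> bigT X (cyc f) :=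
  bigT_unrot X (index ord0 (cyc f)) (cyc f)
  ∘ tr (congr1 (bigT X) (esym (cyc_rot f))).

Section DeltaCP.
Variables (V : csmCat) (VC : countablyCocomplete V) (P : operad V).

(* P[f] *)
Definition Pf m n (f : dmor m n) : V :=
  bigT (fun t => P (size (fib f t))) (enum 'I_n.+1).

Lemma fib_did_size n (t : 'I_n.+1) : 1 = size (fib (did n) t).
Proof. by rewrite fib_did. Qed.

Definition Pf_id n : one ~> Pf (did n) :=
  bigT_units (fun t => opunit P (fib_did_size t)) (enum 'I_n.+1).

Lemma fib_dcomp_size m n p (g : dmor n p) (f : dmor m n) u :
  sumn (map (fun t => size (fib f t)) (fib g u)) = size (fib (dcomp g f) u).
Proof. by rewrite fib_dcomp size_flatten /shape -map_comp. Qed.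

Definition Pf_comp m n p (g : dmor n p) (f : dmor m n) :
  Pf g ⊗ Pf f ~> Pf (dcomp g f) :=
  par (Xs := fib g)
      (fun u => opcomp P (erefl (size (fib g u))) (fib_dcomp_size g f u))
      (enum 'I_p.+1)
  ∘ (idm (Pf g) ⊠ cycT g (fun t => P (size (fib f t)))).

(* As V is closed, a coproduct in either factor of a tensor product can be  *)
(* taken out.                                                               *)
Definition cotuple2 (I J : countType) (F : I -> V) (G : J -> V) (z : V)
    (k : forall i j, F i ⊗ G j ~> z) : coprod VC F ⊗ coprod VC G ~> z :=
  uncurry (cotuple VC (fun i =>
    curry (uncurry (cotuple VC (fun j => curry (k i j ∘ brd (G j) (F i))))
           ∘ brd (F i) (coprod VC G)))).

Lemma cotuple2E (I J : countType) (F : I -> V) (G : J -> V) (z : V)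
    (k : forall i j, F i ⊗ G j ~> z) i j :
  cotuple2 k ∘ (inj VC F i ⊠ inj VC G j) = k i j.
Proof.
rewrite /cotuple2 -tmor_lr compA -uncurry_comp.
rewrite (cotupleE VC (F := F)) curryE -compA (brd_nat (sm_nat V)) compA.
rewrite -uncurry_comp (cotupleE VC (F := G)) curryE -compA.
by rewrite (brdK (sm_coh V)) compm1.
Qed.

Definition DeltaHom m n : V := coprod VC (@Pf m n).

Definition DeltaCP : ecatData V := @EcatData V nat DeltaHom
  (fun n => inj VC (@Pf n n) (did n) ∘ Pf_id n)
  (fun m n p => cotuple2 (fun g f =>
     inj VC (@Pf m p) (dcomp g f) ∘ Pf_comp g f)).
End DeltaCP.

Section CyclicBar.
Variables (V : csmCat) (D : csmecat V) (VC : countablyCocomplete V).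
Variables (P : operad V) (A : algebra D P) (M : bimodule A).

Definition slot m (s : 'I_m.+1) : D := if s == ord0 then bim M else alg A.

(* M ⊗ A^(S - {0}), with the factors of {0, ..., m} in increasing order. *)
Definition BcyOb (m : nat) : D := bigT (M := undM D) (@slot m) (enum 'I_m.+1).

Lemma slot_notin m (l : seq 'I_m.+1) : ord0 \notin l ->
  map (@slot m) l = nseq (size l) (alg A).
Proof.
elim: l => //= s l IH; rewrite inE negb_or => /andP[hs /IH ->].
by rewrite /slot eq_sym (negbTE hs).
Qed.

Lemma slot_fib m n (f : dmor m n) t : (t == ord0) = false ->
  map (@slot m) (fib f t) = nseq (size (fib f t)) (alg A).
Proof.
move=> ht; apply: slot_notin.
apply/negP=> h; move: (cyc_uniq f).
rewrite /cyc enum_ordSl /= cat_uniq => /and3P[_ /negP h0 _].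
apply: h0; apply/hasP; exists ord0; last exact: fib0P.
apply/flatten_mapP; exists t => //.
by have := mem_enum 'I_n.+1 t; rewrite enum_ordSl inE ht.
Qed.

Definition posl m n (f : dmor m n) := index ord0 (fib f ord0).
Definition posr m n (f : dmor m n) := size (fib f ord0) - (posl f).+1.

Lemma pos_size m n (f : dmor m n) :
  (posl f + posr f).+1 = size (fib f ord0).
Proof. by rewrite /posr -addSn subnKC // index_mem fib0P. Qed.

Lemma slot_fib0 m n (f : dmor m n) :
  map (@slot m) (fib f ord0)
  = nseq (posl f) (alg A) ++ bim M :: nseq (posr f) (alg A).
Proof.
have u : uniq (fib f ord0) by apply: fib_uniq.
rewrite /posr /posl; have := fib0P f.
elim: (fib f ord0) u => //= s l IH /andP[hs ul]; rewrite inE eq_sym.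
rewrite {1}/slot; case: eqP hs => [-> hs _|ne _ h].
  by rewrite subn1 slot_notin.
by rewrite IH.
Qed.

Definition BcyAct m n (f : dmor m n) (t : 'I_n.+1) :
  P (size (fib f t)) ~> ehom (bigT (M := undM D) (@slot m) (fib f t) : D)
                             (slot t).
Proof.
rewrite /slot; case: eqP => [->|/eqP/negbTE ht].
- exact: (actOn (bim_act M (posl f) (posr f)) (slot_fib0 f)
          ∘ tr (congr1 P (esym (pos_size f)))).
- exact: (actOn (alg_act A (size (fib f t))) (slot_fib f ht)).
Defined.

Definition BcyMap m n (f : dmor m n) : Pf P f ~> ehom (BcyOb m) (BcyOb n) :=
  epre (D := D) (BcyOb n) (cycT (M := undM D) f (@slot m))
  ∘ epar (Xs := fib f) (BcyAct f) (enum 'I_n.+1).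

(* On Hom(S, T), the coproduct of the P[f], given by the maps              *)
(* P[f] -> Hom(M ⊗ A^(S - {0}), M ⊗ A^(T - {0})).                           *)
Definition Bcy : efunctorData (DeltaCP VC P) D :=
  @EfunctorData V (DeltaCP VC P) D BcyOb
    (fun m n => cotuple VC (@BcyMap m n)).
End CyclicBar.

Section HomInto.
Variables (V : csmCat) (D : ecat V) (K : ecatData V) (F : efunctorData K D).

Definition homInto (B : D) : efunctorData (eop K) (self V) :=
  @EfunctorData V (eop K) (self V) (fun s => ehom (F s) B)
    (fun s t => curry (ecomp (F t) (F s) B ∘ brd _ _
                       ∘ (efmor F t s ⊠ idm (ehom (F s) B)))).

Lemma homInto_push_nat (B B' : D) (h : emor B B') (s t : eop K) :
  let c u : emor (D := self V) (homInto B u) (homInto B' u) :=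
    curry (epost (F u) h ∘ lun (ehom (F u) B)) in
  epost (homInto B s) (c t) ∘ efmor (homInto B) s t
  = epre (homInto B' t) (c s) ∘ efmor (homInto B') s t.
Proof.
move=> c; apply: uncurry_inj.
rewrite uncurry_comp uncurry_epost [RHS]uncurry_comp uncurry_epre.
rewrite -[LHS]compA -[RHS]compA tmor_rl -[in RHS]tmor_lr [RHS]compA.
have E B0 : ev _ _ ∘ (efmor (homInto B0) s t ⊠ idm _)
    = ecomp (F t) (F s) B0 ∘ brd _ _ ∘ (efmor F t s ⊠ idm (ehom (F s) B0)).
  exact: curryK.
rewrite !E -[RHS]compA -[X in _ = _ ∘ X]compA tcomp comp1m compm1.
rewrite -[in RHS]tmor_rl [X in _ = _ ∘ X]compA [in RHS](brd_nat (sm_nat V)).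
rewrite -[X in _ = _ ∘ X]compA [RHS]compA epost_ecomp.
by rewrite -[RHS]compA.
Qed.

Definition homInto_push (B B' : D) (h : emor B B') :
    enat (homInto B) (homInto B') :=
  Enat (homInto_push_nat h).
End HomInto.

Lemma enat_comp_nat (V : smCat) (K : ecatData V) (L : ecat V)
    (F G G' : efunctorData K L) (b : enat G G') (a : enat F G) (x y : K) :
  epost (F x) (ecompm (b y) (a y)) ∘ efmor F x y
  = epre (G' y) (ecompm (b x) (a x)) ∘ efmor G' x y.
Proof.
rewrite epost_comp epre_comp -[LHS]compA (ecpt_nat a).
by rewrite [LHS]compA epost_epre -[LHS]compA (ecpt_nat b) [LHS]compA.
Qed.

Definition enat_comp (V : smCat) (K : ecatData V) (L : ecat V)
    (F G G' : efunctorData K L) (b : enat G G') (a : enat F G) : enat F G' :=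
  Enat (enat_comp_nat b a).

Section Traces.
Variables (V : csmCat) (D : csmecat V) (VC : countablyCocomplete V).
Variables (P : operad V) (A : algebra D P) (M : bimodule A).
Variable R : efunctor (eop (DeltaCP VC P)) (self V).

Definition trace (B : D) : Type := enat R (homInto (Bcy VC M) B).

Definition trace_push (B B' : D) (h : emor B B') (tau : trace B) : trace B' :=
  enat_comp (homInto_push (Bcy VC M) h) tau.
End Traces.

Section TensorOverDelta.
Variables (V : csmCat) (D : csmecat V) (VC : countablyCocomplete V).
Variables (DC : countablyCocomplete (und D)) (P : operad V).
Variable R : efunctor (eop (DeltaCP VC P)) (self V).
Variable F : efunctorData (DeltaCP VC P) D.

Definition Pf_inj m n (f : dmor m n) : Pf P f ~> ehom (e := DeltaCP VC P) m n :=
  inj VC (@Pf V P m n) f.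

(* R(T) ⊗ P[f] -> R(S) *)
Definition Ract m n (f : dmor m n) : R n ⊗ Pf P f ~> R m :=
  uncurry (efmor R n m ∘ Pf_inj f) ∘ brd (R n) (Pf P f).

Definition allDmor : countType := {mn : nat * nat & dmor mn.1 mn.2}.

Definition tensorSrc (x : allDmor) : und D :=
  (R (tag x).2 ⊗ Pf P (tagged x)) ⊙ F (tag x).1.
Definition tensorTgt (m : nat) : und D := R m ⊙ F m.

Definition tensorMapR (x : allDmor) : tensorSrc x ~> coprod DC tensorTgt :=
  inj DC tensorTgt (tag x).1
  ∘ untranspose (etensU (R (tag x).1) (F (tag x).1) ∘ Ract (tagged x)).

Definition tensorMapF (x : allDmor) : tensorSrc x ~> coprod DC tensorTgt :=
  inj DC tensorTgt (tag x).2
  ∘ untranspose (ecomp (F (tag x).1) (F (tag x).2) (R (tag x).2 ⊙ F (tag x).2)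
      ∘ (etensU (R (tag x).2) (F (tag x).2)
           ⊠ (efmor F (tag x).1 (tag x).2 ∘ Pf_inj (tagged x)))).

Definition tensorOver : D :=
  coeq DC (cotuple DC tensorMapR) (cotuple DC tensorMapF).
End TensorOverDelta.

(* Main.v *)
From mathcomp Require Import all_boot.
From Stdlib Require Import FunctionalExtensionality ProofIrrelevance.
Require Import Defs.

Set Implicit Arguments.
Unset Strict Implicit.
Unset Printing Implicit Defensive.

(** A component [one ~> ihom (R m) (ehom (F m) B)] of a trace corresponds to a
map [t m : R m ~> ehom (F m) B], hence to a map [R m ⊙ F m ~> B].  By
closedness of [V] the naturality square may be tested on each summand [P[f]] of
the hom objects, where it says that [t m ∘ Ract f] is the composite of [t n]
with the action of [f] on [F]; after transposition this is the condition that
the induced map out of the coproduct coequalizes the two maps defining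
[tensorOver]. *)

(** The naturality field is a proof, so function extensionality and proof irrelevance leave only the
    components to compare. *)
Lemma eq_enat (V : monCat) (K L : ecatData V) (F G : efunctorData K L)
    (a b : enat F G) : (forall x, a x = b x) -> a = b.
Proof.
case: a b => [a Na] [b Nb] /= E.
have Eab : a = b by apply: functional_extensionality_dep.
by case: b / Eab Nb {E} => Nb; rewrite (proof_irrelevance _ Na Nb).
Qed.

Section SelfElements.
Variable V : csmCat.
Implicit Types x y z : V.

(** With its inverse [unname], this identifies the underlying category of [self V] with [V]. *)
Definition name x y (u : x ~> y) : emor (D := self V) x y := curry (u ∘ lun x).

Definition unname x y (g : emor (D := self V) x y) : x ~> y :=
  uncurry g ∘ lunV x.

Lemma nameK x y (u : x ~> y) : unname (name u) = u.
Proof. by rewrite /unname curryE -compA (lunVK (sm_coh V)) compm1. Qed.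

Lemma unnameK x y (g : emor (D := self V) x y) : name (unname g) = g.
Proof. by rewrite /name /unname -compA (lunK (sm_coh V)) compm1 uncurryK. Qed.

Lemma unname_ecompm x y z (g : emor (D := self V) y z)
    (f : emor (D := self V) x y) : unname (ecompm g f) = unname g ∘ unname f.
Proof.
rewrite -[g in LHS]unnameK {1}/unname /ecompm compA uncurry_comp.
rewrite uncurry_ecomp curryE -!compA (compA (asc _ _ _)) asc_lunV.
by rewrite (compA (idm one ⊠ _)) lunV_nat -compA (compA (lun _))
   (lunVK (sm_coh V)) comp1m.
Qed.

Lemma uncurry_epost_unname x y z (g : emor (D := self V) y z) :
  uncurry (epost (D := self V) x g) = unname g ∘ ev x y.
Proof. by rewrite -[g in LHS]unnameK uncurry_epost. Qed.

Lemma uncurry_epre_unname x y z (g : emor (D := self V) x y) :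
  uncurry (epre (D := self V) z g) = ev y z ∘ (idm _ ⊠ unname g).
Proof. by rewrite -[g in LHS]unnameK uncurry_epre. Qed.

Lemma brd_epi x y z (f g : x ⊗ y ~> z) : f ∘ brd y x = g ∘ brd y x -> f = g.
Proof.
move=> E; rewrite -[f]compm1 -[g]compm1 -(brdK (sm_coh V) x y).
by rewrite !compA E.
Qed.
End SelfElements.

Section TransposeComp.
Variables (V : csmCat) (D : csmecat V).

Lemma transpose_comp (k : V) (x y z : D) (g : emor y z) (f : emor (k ⊙ x) y) :
  transpose (ecompm g f) = epost x g ∘ transpose f.
Proof. by rewrite /transpose epost_comp compA. Qed.

Lemma transpose_inj (k : V) (x y : D) (f g : emor (k ⊙ x) y) :
  transpose f = transpose g -> f = g.
Proof. by move=> E; rewrite -[f]transposeK E transposeK. Qed.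
End TransposeComp.

Section TraceUniversalProperty.
Variables (V : csmCat) (D : csmecat V) (VC : countablyCocomplete V).
Variables (DC : countablyCocomplete (und D)) (P : operad V).
Variable R : efunctor (eop (DeltaCP VC P)) (self V).
Variable F : efunctorData (DeltaCP VC P) D.
Implicit Types B : D.

Definition balanced B (t : forall m, R m ~> ehom (F m) B) : Prop :=
  forall m n (f : dmor m n),
    t m ∘ Ract R f
    = ecomp (F m) (F n) B ∘ (t n ⊠ (efmor F m n ∘ Pf_inj VC P f)).

(** Uncurrying is injective, the braiding is invertible, and maps out of a hom object of [DeltaCP]
    are determined on the summands P[f]. *)
Lemma enat_balancedP B
    (tau : forall m, emor (D := self V) (R m) (homInto F B m)) :
  balanced (fun m => unname (tau m)) <->
  forall n m : eop (DeltaCP VC P),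
    epost (R n) (tau m) ∘ efmor R n m
    = epre (homInto F B m) (tau n) ∘ efmor (homInto F B) n m.
Proof.
(* The braiding arises because uncurrying puts P[f] first, while [Ract] has [R n] first. *)
have side1 m n (f : dmor m n) :
  uncurry ((epost (D := self V) (R n) (tau m) ∘ efmor R n m) ∘ Pf_inj VC P f)
  = (unname (tau m) ∘ Ract R f) ∘ brd (Pf P f) (R n).
  rewrite -compA [LHS]uncurry_comp uncurry_epost_unname /Ract -!compA.
  by rewrite (brdK (sm_coh V)) compm1.
have side2 m n (f : dmor m n) :
  uncurry ((epre (D := self V) (homInto F B m) (tau n)
            ∘ efmor (homInto F B) n m) ∘ Pf_inj VC P f)
  = (ecomp (F m) (F n) B ∘ (unname (tau n) ⊠ (efmor F m n ∘ Pf_inj VC P f)))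
    ∘ brd (Pf P f) (R n).
  rewrite -compA [LHS]uncurry_comp uncurry_epre_unname -[LHS]compA tmor_rl.
  rewrite -[X in _ ∘ X]tmor_lr tmor_compl !compA.
  (* The action of [homInto] is curried; evaluating it gives back precomposition with the action of
     [F]. *)
  have -> : ev _ _ ∘ (efmor (homInto F B) n m ⊠ idm _)
    = ecomp (F m) (F n) B ∘ brd _ _ ∘ (efmor F m n ⊠ idm (ehom (F n) B)).
    exact: curryK.
  by rewrite -!compA -(brd_nat (sm_nat V)) !tE !comp1m !compm1.
split=> [bal n m|nat m n f].
  apply: (coprod_ext (XC := VC)) => f; apply: uncurry_inj.
  rewrite [LHS]side1 [RHS]side2; congr (_ ∘ _); exact: bal.
apply: brd_epi; rewrite -[LHS]side1 -[RHS]side2.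
by congr uncurry; congr (_ ∘ _); apply: nat.
Qed.

(** The universal cowedge, with [tensorOver] viewed as a coend. *)
Definition tensorLeg m : hom (c := und D) (R m ⊙ F m) (tensorOver DC R F) :=
  coeqMap DC _ _ ∘ inj DC (tensorTgt R F) m.

Lemma transpose_tensorMapR B (k : coprod DC (tensorTgt R F) ~> (B : und D))
    m n (f : dmor m n) :
  transpose (k ∘ tensorMapR DC R F (existT _ (m, n) f))
  = transpose (k ∘ inj DC (tensorTgt R F) m) ∘ Ract R f.
Proof.
rewrite /tensorMapR [k ∘ _]compA [LHS]transpose_comp untransposeK.
by rewrite [LHS]compA.
Qed.

(** Postcomposition passes through [ecomp] into its left argument, by [epost_ecomp]. This yields the
    right side of [balanced], as [transpose_tensorMapR] yields the left. *)
Lemma transpose_tensorMapF B (k : coprod DC (tensorTgt R F) ~> (B : und D))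
    m n (f : dmor m n) :
  transpose (k ∘ tensorMapF DC R F (existT _ (m, n) f))
  = ecomp (F m) (F n) B
    ∘ (transpose (k ∘ inj DC (tensorTgt R F) n)
       ⊠ (efmor F m n ∘ Pf_inj VC P f)).
Proof.
rewrite /tensorMapF [k ∘ _]compA [LHS]transpose_comp untransposeK /=.
by rewrite compA -epost_ecomp -compA tcomp comp1m.
Qed.

Lemma balanced_coeqP B (k : coprod DC (tensorTgt R F) ~> (B : und D)) :
  balanced (fun m => transpose (k ∘ inj DC (tensorTgt R F) m)) <->
  k ∘ cotuple DC (tensorMapR DC R F) = k ∘ cotuple DC (tensorMapF DC R F).
Proof.
split=> [bal|E m n f].
  apply: (coprod_ext (XC := DC)) => -[[m n] f]; rewrite -!compA !cotupleE.
  apply: transpose_inj; rewrite transpose_tensorMapR transpose_tensorMapF.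
  exact: bal.
rewrite -transpose_tensorMapR -transpose_tensorMapF; congr transpose.
have : (k ∘ cotuple DC (tensorMapR DC R F)) ∘ inj DC _ (existT _ (m, n) f)
  = (k ∘ cotuple DC (tensorMapF DC R F)) ∘ inj DC _ (existT _ (m, n) f).
  by rewrite E.
by rewrite -!compA !cotupleE.
Qed.

(** The coequalizer map is epi and the coproduct injections are jointly epi, so the legs detect
    equality. *)
Lemma tensorLeg_ext B (g h : emor (tensorOver DC R F) B) :
  (forall m, transpose (ecompm g (tensorLeg m))
             = transpose (ecompm h (tensorLeg m))) -> g = h.
Proof.
move=> E; apply: (coeq_ext (X := und D)); apply: (coprod_ext (XC := DC)) => m.
rewrite -!compA; exact: transpose_inj (E m).
Qed.

Lemma tensorLeg_balanced B (g : emor (tensorOver DC R F) B) :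
  balanced (fun m => transpose (ecompm g (tensorLeg m))).
Proof.
pose k : coprod DC (tensorTgt R F) ~> (B : und D) :=
  (g : hom (c := und D) _ _) ∘ coeqMap DC _ _.
have /balanced_coeqP bal : k ∘ cotuple DC (tensorMapR DC R F)
    = k ∘ cotuple DC (tensorMapF DC R F).
  by rewrite /k -!compA; congr (_ ∘ _); apply: coeqMapE.
(* Reassociation turns [k] on the summand [m] into [g] after [tensorLeg m]. *)
by move=> m n f; have := bal m n f; rewrite /k -!compA.
Qed.

Lemma balanced_cotuple B (t : forall m, R m ~> ehom (F m) B) (bal : balanced t) :
  let k : coprod DC (tensorTgt R F) ~> (B : und D) :=
    cotuple DC (fun m => untranspose (t m)) in
  k ∘ cotuple DC (tensorMapR DC R F) = k ∘ cotuple DC (tensorMapF DC R F).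
Proof.
apply/balanced_coeqP => m n f; rewrite !cotupleE !untransposeK; exact: bal.
Qed.

Definition tensorDesc B (t : forall m, R m ~> ehom (F m) B) (bal : balanced t) :
  emor (tensorOver DC R F) B := coeqDesc DC (balanced_cotuple bal).

Lemma tensorDescE B (t : forall m, R m ~> ehom (F m) B) (bal : balanced t) m :
  transpose (ecompm (tensorDesc bal) (tensorLeg m)) = t m.
Proof.
rewrite -[RHS]untransposeK; congr transpose.
(* [ecompm] is by definition composition in [und D]; this form lets the category and colimit laws
   rewrite. *)
by rewrite -[LHS]/(comp (c := und D) _ _) compA coeqDescE cotupleE.
Qed.

Definition traceToMor B (tau : enat R (homInto F B)) :
    emor (tensorOver DC R F) B :=
  tensorDesc ((enat_balancedP tau).2 (ecpt_nat tau)).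

Lemma traceToMorE B (tau : enat R (homInto F B)) m :
  transpose (ecompm (traceToMor tau) (tensorLeg m)) = unname (tau m).
Proof. exact: tensorDescE. Qed.

Lemma morToTrace_nat B (g : emor (tensorOver DC R F) B)
    (n m : eop (DeltaCP VC P)) :
  let tau m : emor (D := self V) (R m) (homInto F B m) :=
    name (transpose (ecompm g (tensorLeg m))) in
  epost (R n) (tau m) ∘ efmor R n m
  = epre (homInto F B m) (tau n) ∘ efmor (homInto F B) n m.
Proof.
move=> tau; apply: (enat_balancedP tau).1 => {}m {}n f.
by rewrite !nameK; apply: tensorLeg_balanced.
Qed.

Definition morToTrace B (g : emor (tensorOver DC R F) B) :
  enat R (homInto F B) := Enat (morToTrace_nat g).

(** By [traceToMorE] a trace and its morphism carry the same transposed legs, and these determine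
    both of them. *)
Lemma traceToMor_bij B : bijective (@traceToMor B).
Proof.
exists (@morToTrace B) => [tau|g].
  by apply: eq_enat => m /=; rewrite traceToMorE unnameK.
by apply: tensorLeg_ext => m; rewrite traceToMorE nameK.
Qed.

Lemma traceToMor_push B B' (h : emor B B') (tau : enat R (homInto F B)) :
  traceToMor (enat_comp (homInto_push F h) tau) = ecompm h (traceToMor tau).
Proof.
apply: tensorLeg_ext => m; rewrite traceToMorE -ecompmA transpose_comp.
(* Each component of [homInto_push F h] is by definition the [name] of an [epost] by [h], so [nameK]
   applies. *)
by rewrite traceToMorE [LHS]unname_ecompm nameK.
Qed.
End TraceUniversalProperty.

Theorem mainTheorem4 (V : csmCat) (D : csmecat V)
    (VL : countablyComplete V) (VC : countablyCocomplete V)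
    (DL : countablyComplete (und D)) (DC : countablyCocomplete (und D))
    (P : operad V) (A : algebra D P) (M : bimodule A)
    (R : efunctor (eop (DeltaCP VC P)) (self V)) :
  exists Phi : forall B : D,
      trace M R B -> emor (tensorOver DC R (Bcy VC M)) B,
    (forall B, bijective (Phi B)) /\
    (forall (B B' : D) (h : emor B B') (tau : trace M R B),
       Phi B' (trace_push h tau) = ecompm h (Phi B tau)).
Proof.
(* The universal property for general [F] is specialised to the cyclic bar construction. *)
exists (fun B => @traceToMor V D VC DC P R (Bcy VC M) B); split=> [B|B B' h tau].
  exact: traceToMor_bij.
exact: traceToMor_push.
Qed.
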